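(* Let $G$ be a graph of order $n$ such that every component of $G$ and every component of its complement $\overline{G}$ has order at least $3$. If $n\notin\{13,14,16,17,20\}$, then $$\gamma_P(G)+\gamma_P(\overline{G})\le \left\lfloor\frac{n}{3}\right\rfloor+2,$$ and this bound is attained for arbitrarily large $n$ by $G=rK_3$, the disjoint union of $r$ copies of $K_3$, where $r\ge 2$. If $n\in\{13,14,16,17,20\}$, then $$\gamma_P(G)+\gamma_P(\overline{G})\le \left\lfloor\frac{n}{3}\right\rfloor+3.$$
   Context: All graphs are finite, simple, undirected, with nonempty vertex set; the order is the number of vertices. $N(v)$ is the set of neighbors of $v$, $N[v]=N(v)\cup\{v\}$, and $N[S]=\bigcup_{v\in S}N[v]$. For $S\subseteq V(G)$, define $PD(S)$ by: (1) start with $PD(S):=N[S]$; (2) while there exists $v\in PD(S)$ with $|N(v)\setminus PD(S)|=1$, set $PD(S):=PD(S)\cup N(v)$. $S$ is a power dominating set if $PD(S)=V(G)$ at the end of the process. The power domination number $\gamma_P(G)$ is the minimum cardinality of a power dominating set of $G$. A component is a maximal connected subgraph. *)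

(* Defs.v *)
From HB Require Import structures.
From mathcomp Require Import all_boot.

Set Implicit Arguments.
Unset Strict Implicit.
Unset Printing Implicit Defensive.

Record sgraph := SGraph {
  vertex :> finType;
  edge : rel vertex;
  edge_sym : symmetric edge;
  edge_irr : irreflexive edge }.

Section Complement.
Variable G : sgraph.

Definition co_edge : rel G := [rel x y | (x != y) && ~~ edge x y].

Lemma co_edge_sym : symmetric co_edge.
Proof. by move=> x y; rewrite /co_edge /= eq_sym edge_sym. Qed.

Lemma co_edge_irr : irreflexive co_edge.
Proof. by move=> x; rewrite /co_edge /= eqxx. Qed.

Definition complement : sgraph := SGraph co_edge_sym co_edge_irr.
End Complement.

Section CompleteGraph.
Variable n : nat.

Definition complete_edge : rel 'I_n := [rel x y | x != y].

Lemma complete_edge_sym : symmetric complete_edge.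
Proof. by move=> x y; rewrite /complete_edge /= eq_sym. Qed.

Lemma complete_edge_irr : irreflexive complete_edge.
Proof. by move=> x; rewrite /complete_edge /= eqxx. Qed.

Definition complete_graph : sgraph := SGraph complete_edge_sym complete_edge_irr.
End CompleteGraph.

Section Copies.
Variables (r : nat) (G : sgraph).

Definition copies_edge : rel ('I_r * G) :=
  [rel u v | (u.1 == v.1) && edge u.2 v.2].

Lemma copies_edge_sym : symmetric copies_edge.
Proof. by move=> u v; rewrite /copies_edge /= eq_sym edge_sym. Qed.

Lemma copies_edge_irr : irreflexive copies_edge.
Proof. by move=> u; rewrite /copies_edge /= edge_irr andbF. Qed.

(* The disjoint union of r copies of G; vertex (i, x) is x in the i-th copy. *)
Definition copies : sgraph := SGraph copies_edge_sym copies_edge_irr.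
End Copies.

Section Components.
Variable G : sgraph.

Definition connected_set (C : {set G}) :=
  (C != set0) &&
  [forall x in C, forall y in C,
     connect [rel u v | [&& u \in C, v \in C & edge u v]] x y].

(* A maximal connected subgraph is induced, so it is given by its vertices. *)
Definition component (C : {set G}) := maxset connected_set C.

Definition components_ge (k : nat) :=
  forall C : {set G}, component C -> k <= #|C|.
End Components.

Section PowerDomination.
Variable G : sgraph.

Definition nbhd (v : G) : {set G} := [set w | edge v w].
Definition closed_nbhd (v : G) : {set G} := v |: nbhd v.
Definition closed_nbhds (S : {set G}) : {set G} :=
  \bigcup_(v in S) closed_nbhd v.

(* One round of the "while" loop, for an arbitrary admissible choice of v. *)
Definition pd_step : rel {set G} :=
  [rel P Q : {set G} |
    [exists v in P, (#|nbhd v :\: P| == 1) && (Q == P :|: nbhd v)]].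

Definition pd_reach (S : {set G}) : pred {set G} :=
  connect pd_step (closed_nbhds S).

Definition pd_final (S P : {set G}) :=
  pd_reach S P && [forall Q, ~~ pd_step P Q].

(* Whatever the choices, the loop ends, and always with the same set [PD S]:  *)
(* see [pd_final_PD] and [pd_final_uniq].                                     *)
Definition PD (S : {set G}) : {set G} :=
  odflt set0 [pick P | pd_final S P].

Definition power_dominating (S : {set G}) := PD S == [set: G].

Definition power_domination_number : nat :=
  #|[arg min_(S < [set: G] | power_dominating S) #|S| ]|.

Lemma pd_step_card (P Q : {set G}) : pd_step P Q -> #|P| < #|Q|.
Proof.
case/exists_inP=> v _ /andP[/cards1P[w Ew] /eqP->]; apply: proper_card.
rewrite properE subsetUl; apply/subsetPn; exists w.
  by rewrite inE; have/setDP[-> _]: w \in nbhd v :\: P;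
    rewrite ?orbT // Ew set11.
by have/setDP[_ ->]: w \in nbhd v :\: P by rewrite Ew set11.
Qed.

Lemma pd_final_exists (S : {set G}) : exists P, pd_final S P.
Proof.
case: (@arg_maxnP _ (closed_nbhds S) (pd_reach S) (fun P => #|P|)).
  exact: connect0.
move=> P SP maxP; exists P; rewrite /pd_final SP; apply/forallP=> Q.
apply/negP=> PQ; have := maxP Q (connect_trans SP (connect1 PQ)).
by rewrite /= leqNgt (pd_step_card PQ).
Qed.

Lemma pd_final_uniq (S P Q : {set G}) :
  pd_final S P -> pd_final S Q -> P = Q.
Proof.
suff sub A B : pd_reach S A -> pd_final S B -> A \subset B.
  move=> fP fQ; case/andP: (fP) (fQ) => rP _ /andP[rQ _].
  by apply/eqP; rewrite eqEsubset !sub.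
case/connectP=> p pth ->{A} /andP[SB /forallP finB].
have {SB} : closed_nbhds S \subset B.
  case/connectP: SB => q qth ->{finB}.
  elim: q (closed_nbhds S) qth => //= C q IH A.
  case/andP=> /exists_inP[v _ /andP[_ /eqP EC]] /IH; apply: subset_trans.
  by rewrite EC subsetUl.
elim: p (closed_nbhds S) pth => //= C p IH A /andP[AC pth] sAB.
apply: IH pth _; case/exists_inP: AC => v vA /andP[cv /eqP->].
rewrite subUset sAB -setD_eq0 -cards_eq0 /=.
have: #|nbhd v :\: B| <= 1 by rewrite -(eqP cv) subset_leq_card ?setDS.
have: #|nbhd v :\: B| != 1.
  apply: contra (finB (B :|: nbhd v)) => c1.
  by apply/exists_inP; exists v; rewrite ?(subsetP sAB) // c1 eqxx.
by case: #|_| => [|[]].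
Qed.

Lemma pd_final_PD (S : {set G}) : pd_final S (PD S).
Proof.
rewrite /PD; case: pickP => //= noP.
by have [P] := pd_final_exists S; rewrite noP.
Qed.

Lemma power_dominating_setT : power_dominating [set: G].
Proof.
have fT : pd_final [set: G] [set: G].
  have ET : closed_nbhds [set: G] = [set: G].
    apply/setP=> v; rewrite !inE; apply/bigcupP.
    by exists v; rewrite ?inE ?eqxx.
  apply/andP; split; first by rewrite /pd_reach ET connect0.
  apply/forallP=> Q; apply/negP=> /pd_step_card.
  by rewrite cardsT ltnNge max_card.
by apply/eqP/(pd_final_uniq (pd_final_PD _) fT).
Qed.

Lemma power_domination_number_min (S : {set G}) :
  power_dominating S -> power_domination_number <= #|S|.
Proof.
rewrite /power_domination_number.
by case: arg_minnP => [|A _ minA]; [exact: power_dominating_setT | exact: minA].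
Qed.

Lemma power_domination_number_attained :
  exists2 S : {set G}, power_dominating S & #|S| = power_domination_number.
Proof.
rewrite /power_domination_number.
case: arg_minnP => [|A pA _]; first exact: power_dominating_setT.
by exists A.
Qed.
End PowerDomination.

(* Main.v *)
Require Import Defs.
From mathcomp Require Import all_boot.
From mathcomp Require Import zify.

Set Implicit Arguments.
Unset Strict Implicit.
Unset Printing Implicit Defensive.

(* Let p and q be the power domination numbers of G and of its complement, on *)
(* n vertices. A minimum power dominating set with as many inner edges as     *)
(* possible has two private neighbours per vertex, so p, q <= n/3; this       *)
(* settles the case where p or q is at most 2. Otherwise the Jaeger-Payan     *)
(* inequality gives p q <= n, so for n outside the exceptional list only      *)
(* {p, q} = {3, floor(n/3)} remains. As a power dominating set only has to    *)
(* dominate all vertices but one, any two vertices have two common neighbours *)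
(* in G and two in the complement. Hence all degrees in G exceed p, and the   *)
(* greedy choice of p - 1 vertices leaves at most one vertex undominated,     *)
(* except for n = 10, 11. There, counting paths of length two in both graphs  *)
(* shows that most pairs have exactly two common neighbours; those two are    *)
(* then twins, but twins have too many common neighbours themselves.          *)

(** The link between power domination and counting is that, in a graph without isolated vertices,
    $N[S]$ may miss one vertex ([power_dominating_defect]), or two that are not twins
    ([defect2_twins]), and [S] is still power dominating. The vertices left undominated by a pair in
    one graph are its common neighbours in the other ([undominated_pair], [undominated_pair_co]), so
    $p, q \ge 3$ forces all common neighbourhoods to be large in both graphs.

    The constraints $3p, 3q \le n$ ([power_domination_third]), $pq \le n$ ([jaeger_payan]) and the
    greedy inequality ([power_domination_greedy]) meet in [sum_le_third]. The exceptional orders are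
    those where they still admit one more, such as $p = q = 4$ for $n = 16$. For $rK_3$, every copy
    must be met by a power dominating set, and the complement needs two vertices. *)

Section Propagation.
Variable G : sgraph.
Implicit Types (S P : {set G}) (u v w x y : G).

Definition stalled P := [forall v in P, #|nbhd v :\: P| != 1].

Lemma mem_closed_nbhds S w :
  reflect (exists2 v, v \in S & (w == v) || edge v w) (w \in closed_nbhds S).
Proof.
by apply: (iffP bigcupP) => -[v vS vw]; exists v => //; move: vw; rewrite !inE.
Qed.

Lemma mem_closed_nbhdsI S v w :
  v \in S -> (w == v) || edge v w -> w \in closed_nbhds S.
Proof. by move=> vS vw; apply/mem_closed_nbhds; exists v. Qed.

(** Whatever the order of the steps, the loop ends in the least stalled set containing
    [closed_nbhds S]. Later arguments quantify over stalled sets and never run the loop. *)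
Lemma power_dominatingP S :
  reflect (forall P, closed_nbhds S \subset P -> stalled P -> P = setT)
          (power_dominating S).
Proof.
have /andP[reachPD /forallP stopPD] := pd_final_PD S.
apply: (iffP eqP) => [PDT P sSP /forall_inP stP | stT].
  apply/eqP; rewrite -subTset -PDT.
  case/connectP: reachPD => p pth ->{PDT stopPD}.
  elim: p (closed_nbhds S) pth sSP => //= C p IH A /andP[AC pth] sAP.
  apply: IH pth _; case/exists_inP: AC => v vA /andP[/eqP cv /eqP->].
  rewrite subUset sAP -setD_eq0 -cards_eq0 /=.
  have: #|nbhd v :\: P| <= 1 by rewrite -cv subset_leq_card ?setDS.
  by case: #|_| (stP v (subsetP sAP v vA)) => [|[]].
apply: stT.
  case/connectP: reachPD => p pth ->.
  elim: p (closed_nbhds S) pth => //= C p IH A /andP[AC pth].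
  apply: subset_trans (IH _ pth).
  by case/exists_inP: AC => v _ /andP[_ /eqP->]; rewrite subsetUl.
apply/forall_inP=> v vP; apply: contra (stopPD (PD S :|: nbhd v)) => cv.
by apply/exists_inP; exists v; rewrite // cv eqxx.
Qed.

Lemma stalled_nbhd_sub P v :
  stalled P -> v \in P -> #|nbhd v :\: P| <= 1 -> nbhd v \subset P.
Proof.
move=> /forall_inP stP vP; have := stP v vP.
by rewrite -setD_eq0 -cards_eq0; case: #|_| => [|[]].
Qed.

Lemma dominating_power S : closed_nbhds S = setT -> power_dominating S.
Proof.
by move=> ST; apply/power_dominatingP=> P; rewrite ST subTset => /eqP.
Qed.

(** A single missing vertex has a neighbour, which lies in [P] and has no other neighbour outside,
    so it would force. *)
Lemma stalled_defect P :
  (forall v, exists w, edge v w) -> stalled P -> #|~: P| <= 1 -> P = setT.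
Proof.
move=> noiso stP P1; apply/setP=> x; rewrite inE; apply/idPn=> xP.
have PE : ~: P = [set x].
  by apply/esym/eqP; rewrite eqEcard sub1set inE xP cards1.
have [w xw] := noiso x; have wP : w \in P.
  by rewrite -[P]setCK PE !inE; apply: contraTneq xw => ->; rewrite edge_irr.
have: x \in P.
  apply: (subsetP (stalled_nbhd_sub stP wP _)); last by rewrite inE edge_sym.
  by rewrite setDE PE -(cards1 x) subset_leq_card ?subsetIr.
by rewrite (negPf xP).
Qed.

Lemma power_dominating_defect S :
  (forall v, exists w, edge v w) -> #|~: closed_nbhds S| <= 1 ->
  power_dominating S.
Proof.
move=> noiso U1; apply/power_dominatingP=> P sSP stP; apply: stalled_defect=> //.
by apply: (leq_trans _ U1); apply: subset_leq_card; rewrite setCS.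
Qed.

(** Adjacency between [x] and [y] is left open, which makes the notion invariant under
    complementation. *)
Definition twins x y :=
  (x != y) && [forall w, (w != x) ==> (w != y) ==> (edge w x == edge w y)].

(** A third vertex adjacent to exactly one of [x], [y] is already observed and forces that one; the
    other is then a defect of one vertex. *)
Lemma defect2_twins S x y :
  (forall v, exists w, edge v w) -> x != y ->
  ~: closed_nbhds S = [set x; y] -> ~~ power_dominating S -> twins x y.
Proof.
move=> noiso xy UE; apply: contraR; rewrite /twins xy.
case/forallPn=> w; rewrite !negb_imply => /and3P[wx wy dw].
apply/power_dominatingP=> P sSP stP; apply: stalled_defect => //.
have sPU z : z \notin P -> (z == x) || (z == y).
  move=> zP; have: z \in ~: closed_nbhds S.
    by rewrite inE; apply: contra zP; apply/subsetP.
  by rewrite UE !inE.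
have wP : w \in P by apply: contraNT wx => /sPU; rewrite (negPf wy) orbF.
have force a b : (forall z, z \notin P -> (z == a) || (z == b)) ->
    edge w a -> ~~ edge w b -> #|~: P| <= 1.
  move=> sPab wa wb; have aP : a \in P.
    apply: (subsetP (stalled_nbhd_sub stP wP _)); last by rewrite inE.
    rewrite -(cards1 a); apply/subset_leq_card/subsetP=> z.
    rewrite !inE => /andP[/sPab/orP[//|/eqP->]].
    by rewrite (negPf wb).
  rewrite -(cards1 b); apply/subset_leq_card/subsetP=> z.
  rewrite !inE => zP; case/orP: (sPab z zP) => // /eqP za.
  by move: zP; rewrite za aP.
move: dw; case wx': (edge w x); case wy': (edge w y) => // _.
  by apply: (force x y) => //; rewrite wy'.
by apply: (force y x); rewrite ?wx' // => z /sPU; rewrite orbC.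
Qed.

(* A replacement for [v] may drop one vertex of [N(v)], because [v], still    *)
(* being observed, then forces that vertex.                                   *)
Lemma power_dominating_exchange S S' v :
  power_dominating S -> S :\ v \subset S' -> v \in closed_nbhds S' ->
  #|nbhd v :\: closed_nbhds S'| <= 1 -> power_dominating S'.
Proof.
move=> /power_dominatingP pdS sSS' vS' N1; apply/power_dominatingP=> P sP stP.
apply: (pdS P _ stP); have vP := subsetP sP v vS'.
have /subsetP sNP : nbhd v \subset P.
  apply: stalled_nbhd_sub => //; apply: (leq_trans _ N1).
  by apply: subset_leq_card; apply: setDS.
apply/subsetP=> w /mem_closed_nbhds[u uS]; have [->|uv] := eqVneq u v.
  by case/orP=> [/eqP->|vw] //; apply: sNP; rewrite inE.
move=> uw; apply: (subsetP sP); apply: mem_closed_nbhdsI uw.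
by apply: (subsetP sSS'); rewrite !inE uv.
Qed.

Definition private_nbrs S v :=
  [set w | (w \notin S) && (nbhd w :&: S == [set v])].

(** Private neighbourhoods of distinct vertices are disjoint and avoid [S], so $2|S| \le n -
    |S|$. *)
Lemma private_nbrs_card S :
  (forall v, v \in S -> 2 <= #|private_nbrs S v|) -> 3 * #|S| <= #|G|.
Proof.
move=> priv; have : \sum_(v in S) 2 <= \sum_(v in S) #|private_nbrs S v|.
  exact: leq_sum.
suff : \sum_(v in S) #|private_nbrs S v| <= #|~: S|.
  by rewrite sum_nat_const -(cardsC S); lia.
rewrite /private_nbrs; under eq_bigr => v _ do rewrite -sum1_card big_mkcond.
rewrite exchange_big -sum1_card [leqRHS]big_mkcond /=; apply: leq_sum => w _.
rewrite -big_mkcondr sum1_card /= inE.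
case: (boolP (w \in S)) => wS; last first.
  case: (pickP [pred v | nbhd w :&: S == [set v]]) => [v0 /= /eqP Ev0|no].
    rewrite -(card1 v0); apply/subset_leq_card/subsetP=> v.
    rewrite unfold_in inE Ev0 => /and3P[_ _ /eqP/set1_inj->]; exact: eqxx.
  rewrite eq_card0 // => v; rewrite unfold_in inE.
  by have /= -> := no v; rewrite !andbF.
by rewrite eq_card0 // => v; rewrite unfold_in inE wS andbF.
Qed.

Definition edges_in S := [set p in setX S S | edge p.1 p.2].
Definition nonleaves S := [set v in S | 2 <= #|nbhd v|].

(* Among the minimum power dominating sets, take one with as many inner edges *)
(* and then as many nonleaves as possible. A vertex of it with at most one    *)
(* private neighbour could be exchanged for one of its neighbours.            *)
Lemma power_domination_third :
  (forall v, exists w, edge v w) ->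
  (forall v w, edge v w ->
     exists z, [&& z != v, z != w & edge v z || edge w z]) ->
  3 * power_domination_number G <= #|G|.
Proof.
move=> noiso noK2; have [S0 pdS0 cS0] := power_domination_number_attained G.
(* Lexicographic order in one number: the factor [#|G|.+1] exceeds any count of nonleaves. *)
pose phi S := #|edges_in S| * #|G|.+1 + #|nonleaves S|.
pose good S := power_dominating S && (#|S| == power_domination_number G).
have goodS0 : good S0 by rewrite /good pdS0 cS0 eqxx.
case: (@arg_maxnP _ S0 good phi goodS0) => S /andP[pdS /eqP cS] maxS.
rewrite -cS; apply: private_nbrs_card => v vS; rewrite leqNgt; apply/negP=> epn1.
(* A neighbour of [v] that [S'] leaves undominated is a private neighbour of [v], and there is at
   most one, so the exchange lemma applies. *)
have sub_epn S' : S :\ v \subset S' -> v \in closed_nbhds S' ->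
    power_dominating S'.
  move=> sSS' vS'; apply: (power_dominating_exchange pdS sSS' vS').
  rewrite -ltnS; apply: leq_ltn_trans epn1; apply/subset_leq_card/subsetP=> w.
  rewrite !inE => /andP[wS' vw].
  have noS' u : u \in S -> u != v -> ~~ ((w == u) || edge u w).
    move=> uS uv; apply: contra wS' => uw; apply: mem_closed_nbhdsI uw.
    by apply: (subsetP sSS'); rewrite !inE uv.
  apply/andP; split.
    have wv : w != v by apply: contraTneq vw => ->; rewrite edge_irr.
    by apply: contraT => /negPn wS; have := noS' w wS wv; rewrite eqxx.
  apply/eqP/setP=> u; rewrite !inE; have [->|uv] := eqVneq u v.
    by rewrite edge_sym vw.
  by apply/andP=> -[wu /noS'/(_ uv)]; rewrite edge_sym wu orbT.
(* Otherwise [S :\ v] would still dominate [v] and be a smaller power dominating set. *)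
have indep u : u \in S -> edge v u = false.
  move=> uS; apply/negP=> vu.
  have uv : u != v by apply: contraTneq vu => ->; rewrite edge_irr.
  have vS' : v \in closed_nbhds (S :\ v).
    by apply: (@mem_closed_nbhdsI _ u); rewrite ?inE ?uv // edge_sym vu orbT.
  have := power_domination_number_min (sub_epn _ (subxx _) vS').
  by rewrite -cS [#|S|](cardsD1 v) vS; lia.
pose S_ w := w |: S :\ v.
have goodS_ w : edge v w -> good (S_ w).
  move=> vw; have wS : w \notin S by apply: contraTN vw => /indep->.
  rewrite /good sub_epn ?subsetU1 //=; last first.
    by apply: (@mem_closed_nbhdsI _ w); rewrite ?setU11 // edge_sym vw orbT.
  by rewrite -cS [#|S|](cardsD1 v) vS cardsU1 !inE (negPf wS) andbF.
have edgesS_ w : edges_in S \subset edges_in (S_ w).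
  apply/subsetP=> -[a b]; rewrite !inE /= => /andP[/andP[aS bS] ab].
  have -> : a != v by apply: contraTneq ab => ->; rewrite indep.
  have -> : b != v by apply: contraTneq ab => ->; rewrite edge_sym indep.
  by rewrite aS bS ab !orbT.
(* If a neighbour [w] of [v] sees another [u] in [S], swapping [v] for [w] gains the inner edge [uw]
   and loses none, since [v] has no neighbour in [S]. *)
have [|nou] := boolP [exists w, [exists u in S, [&& edge v w, u != v & edge u w]]].
  case/existsP=> w /exists_inP[u uS /and3P[vw uv uw]].
  have wS : w \notin S by apply: contraTN vw => /indep->.
  have := maxS _ (goodS_ w vw); rewrite /phi.
  have : #|edges_in S| < #|edges_in (S_ w)|.
    apply/proper_card/properP; split=> //; exists (u, w).
      by rewrite !inE /= eqxx uS uv uw !orbT.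
    by rewrite !inE /= (negPf wS) andbF.
  have : #|nonleaves S| <= #|G| by apply: max_card.
  move: #|_| #|_| #|_| #|nonleaves _| #|G| => a b c d m *; nia.
(* Now all neighbours of [v] are private, so [v] is a leaf at some [w]. By [noK2], [w] has a further
   neighbour, and swapping [v] for [w] gains a nonleaf. *)
have priv w : edge v w -> w \in private_nbrs S v.
  move=> vw; rewrite inE; apply/andP; split.
    by apply: contraTN vw => /indep->.
  apply/eqP/setP=> u; rewrite !inE; have [->|uv] := eqVneq u v.
    by rewrite edge_sym vw.
  apply/andP=> -[wu uS]; case/existsP: nou; exists w; apply/exists_inP.
  by exists u; rewrite // vw uv edge_sym.
have [w vw] := noiso v; have wS : w \notin S by apply: contraTN vw => /indep->.
have Nv z : edge v z -> z = w.
  move=> vz; apply/eqP; apply: contraTT epn1 => zw; rewrite -leqNgt.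
  have <- : #|[set z; w]| = 2 by rewrite cards2 zw.
  by apply/subset_leq_card/subsetP=> x; rewrite inE => /orP[]/set1P->; apply: priv.
have [z /and3P[zv zw vwz]] := noK2 v w vw.
have wz : edge w z by case/orP: vwz => // /Nv zE; rewrite zE eqxx in zw.
have : #|nonleaves S| < #|nonleaves (S_ w)|.
  apply/proper_card/properP; split.
    apply/subsetP=> x; rewrite !inE => /andP[xS x2]; rewrite xS x2 !andbT.
    suff -> : x != v by rewrite orbT.
    apply: contraTneq x2 => ->; rewrite -leqNgt -(cards1 w).
    by apply/subset_leq_card/subsetP=> y; rewrite !inE => /Nv->.
  exists w; last by rewrite inE (negPf wS).
  rewrite !inE eqxx /=; have <- : #|[set v; z]| = 2 by rewrite cards2 eq_sym zv.
  apply/subset_leq_card/subsetP=> x; rewrite !inE => /orP[]/eqP-> //.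
  by rewrite edge_sym.
have := maxS _ (goodS_ w vw); rewrite /phi.
have := subset_leq_card (edgesS_ w).
move: #|_| #|_| #|nonleaves _| #|_| #|G| => a b c d m ba phi_le cd.
by have := leq_mul ba (leqnn m.+1); lia.
Qed.
End Propagation.

(** * The Jaeger-Payan inequality for domination in a graph and its complement *)

Section JaegerPayan.
Variable G : sgraph.
Implicit Types (f : {ffun G -> G}) (S : {set G}) (x y z : G).

(** A partition is encoded by the fibres of [f], with vertices as labels, so that partitions form a
    finite type over which a minimum exists. *)
Definition full f x := [forall y, (f y == f x) ==> ((y == x) || edge x y)].

Lemma fullP f x :
  reflect (forall y, f y = f x -> (y == x) || edge x y) (full f x).
Proof.
apply: (iffP forallP) => [h y /eqP fy|h y].
  by have := h y; rewrite fy.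
by apply/implyP=> /eqP /h.
Qed.

Definition star_partition f := [forall x, exists z, (f z == f x) && full f z].

Lemma star_partitionP f :
  reflect (forall x, exists2 z, f z = f x & full f z) (star_partition f).
Proof.
apply: (iffP forallP) => h x; have := h x.
  by case/existsP=> z /andP[/eqP]; exists z.
by case=> z zx fz; apply/existsP; exists z; rewrite zx eqxx.
Qed.

(** One full vertex chosen from each part dominates the graph. *)
Lemma star_partition_dominating f :
  star_partition f ->
  exists2 S : {set G}, closed_nbhds S = setT & #|S| <= #|f @: [set: G]|.
Proof.
move/star_partitionP=> stf.
pose g l := odflt l [pick z | (f z == l) && full f z].
exists (g @: (f @: [set: G])); last exact: leq_imset_card.
apply/setP=> x; rewrite inE; apply: (@mem_closed_nbhdsI _ _ (g (f x))).
  by rewrite !imset_f ?inE.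
rewrite /g; case: pickP => [z /andP[/eqP zx /fullP fz]|no] /=.
  exact: fz.
by have [z zx fz] := stf x; have := no z; rewrite zx eqxx fz.
Qed.

(* Take a partition into stars with as few parts as possible and, subject to  *)
(* that, with as many full vertices (adjacent to the rest of their part) as   *)
(* possible. A vertex [x] outside a part [l], adjacent to all of it, could be *)
(* moved to [l]; so every part dominates the complement.                      *)
Lemma jaeger_payan a b :
  (forall S, closed_nbhds S = setT -> a <= #|S|) ->
  (forall S : {set G}, @closed_nbhds (complement G) S = setT -> b <= #|S|) ->
  a * b <= #|G|.
Proof.
move=> domG domH.
pose phi f := #|f @: [set: G]| * #|G|.+1 + #|[set x | ~~ full f x]|.
have st0 : star_partition [ffun x => x].
  apply/star_partitionP=> x; exists x => //; apply/fullP=> y.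
  by rewrite !ffunE => ->; rewrite eqxx.
case: (@arg_minnP _ _ star_partition phi st0) => f stf minf.
have [S domS cS] := star_partition_dominating stf.
apply: leq_trans (leq_mul (leq_trans (domG S domS) cS) (leqnn b)) _.
have -> : #|G| = \sum_(l in f @: [set: G]) #|[set x | f x == l]|.
  rewrite -cardsT -sum1_card (partition_big f (mem (f @: [set: G]))) /=.
    by apply: eq_bigr => l _; rewrite sum1dep_card; apply: eq_card => x; rewrite !inE.
  by move=> x _; rewrite imset_f ?inE.
rewrite -sum_nat_const; apply: leq_sum => l /imsetP[x0 _ ->{l}].
apply: domH; set F := [set x | f x == f x0].
suff dom (x : G) : x \in @closed_nbhds (complement G) F.
  by apply/setP=> x; rewrite dom inE.
apply: contraT => xdom.
(* A vertex that [F] does not dominate in the complement lies outside [F] and is adjacent in [G] to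
   all of [F]. *)
have xadj y : f y = f x0 -> edge x y && (x != y).
  move=> fy; apply: contraNT xdom => nxy; apply: (@mem_closed_nbhdsI (complement G) _ y).
    by rewrite inE fy.
  rewrite /= /co_edge /= [y == x]eq_sym edge_sym.
  by move: nxy; case: (x == y); case: (edge x y).
have fx : f x != f x0 by apply/negP=> /eqP/xadj; rewrite eqxx andbF.
(* If [x] is full in its own part, merging that whole part into [F] keeps [x] full and saves a
   part. *)
have [/fullP fullx|nfullx] := boolP (full f x).
  pose f' := [ffun y => if f y == f x then f x0 else f y].
  have fullf' y : f y != f x -> f y != f x0 -> full f y -> full f' y.
    move=> yx yx0 /fullP fy; apply/fullP=> z; rewrite !ffunE (negPf yx).
    by case: ifP => [_ E|_]; [rewrite E eqxx in yx0 | apply: fy].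
  have st' : star_partition f'.
    apply/star_partitionP=> y; rewrite ffunE.
    have full'x : full f' x.
      apply/fullP=> z; rewrite !ffunE eqxx; case: eqP => [/fullx //|_].
      by case/xadj/andP=> ->; rewrite orbT.
    have [yx|yx] := eqVneq (f y) (f x); first by exists x; rewrite // ffunE eqxx.
    have [yx0|yx0] := eqVneq (f y) (f x0).
      by exists x; rewrite // ffunE eqxx yx0.
    have [z zy fz] := (star_partitionP _ stf) y.
    by exists z; rewrite ?ffunE ?zy ?(negPf yx) // fullf' ?zy.
  have : #|f' @: [set: G]| < #|f @: [set: G]|.
    apply/proper_card/properP; split.
      apply/subsetP=> _ /imsetP[y _ ->]; rewrite ffunE.
      by case: ifP => _; apply: imset_f; rewrite inE.
    exists (f x); first by rewrite imset_f ?inE.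
    apply/negP=> /imsetP[y _]; rewrite ffunE; case: eqP => [_|yx] E.
      by rewrite E eqxx in fx.
    by rewrite E in yx.
  have := minf _ st'; rewrite /phi.
  have := max_card (mem [set x | ~~ full f' x]).
  move: #|_| #|_| #|_| #|_| #|G| => i j k m n *; nia.
(* If [x] is not full, it moves alone: its old part keeps its full vertex, full vertices of [F] stay
   full because they are adjacent to [x], and [x] becomes full. *)
pose f' := [ffun y => if y == x then f x0 else f y].
have f'E y : y != x -> f' y = f y by move=> yx; rewrite ffunE (negPf yx).
have fullf' y : full f y -> full f' y.
  move=> fully; have yx : y != x by apply: contraTneq fully => ->.
  apply/fullP=> z; rewrite (f'E y yx) ffunE.
  case: (eqVneq z x) => [->|zx]; last by move: fully => /fullP/(_ z).
  by move=> fy; have /andP[] := xadj y (esym fy); rewrite edge_sym => ->; rewrite orbT.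
have full'x : full f' x.
  apply/fullP=> z; have [-> //|zx] := eqVneq z x.
  by rewrite f'E // ffunE eqxx => /xadj/andP[->].
have st' : star_partition f'.
  apply/star_partitionP=> y; have [->|yx] := eqVneq y x; first by exists x.
  rewrite f'E //; have [z zy fz] := (star_partitionP _ stf) y.
  have zx : z != x by apply: contraNneq nfullx => <-.
  by exists z; rewrite ?f'E ?fullf'.
have : #|f' @: [set: G]| <= #|f @: [set: G]|.
  apply/subset_leq_card/subsetP=> _ /imsetP[y _ ->]; rewrite ffunE.
  by case: ifP => _; apply: imset_f; rewrite inE.
have : #|[set x | ~~ full f' x]| < #|[set x | ~~ full f x]|.
  apply/proper_card/properP; split.
    by apply/subsetP=> y; rewrite !inE; apply/contra/fullf'.
  by exists x; rewrite !inE ?nfullx ?full'x.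
have := minf _ st'; rewrite /phi.
move: #|_| #|_| #|_| #|_| #|G| => i j k m n *; nia.
Qed.

End JaegerPayan.

(** * Greedy domination *)

Section Greedy.
Variable G : sgraph.
Implicit Types (S : {set G}) (x y z : G).

(* Averaging over [w], some vertex dominates at least the fraction            *)
(* [(n - d) / n] of what [S] leaves undominated.                              *)
Lemma greedy_dominating d :
  0 < #|G| -> (forall v : G, #|~: closed_nbhd v| <= d) ->
  forall k, exists2 S : {set G},
    #|S| <= k & #|~: closed_nbhds S| * #|G| ^ k <= #|G| * d ^ k.
Proof.
move=> n0 degG; elim=> [|k [S cS US]].
  exists set0; first by rewrite cards0.
  by rewrite !expn0 !muln1 max_card.
have /card_gt0P[w0 _] := n0; pose U := ~: closed_nbhds S.
case: (@arg_minnP _ w0 predT (fun w => #|U :\: closed_nbhd w|) isT) => w _ minw.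
have avg : #|U :\: closed_nbhd w| * #|G| <= #|U| * d.
  apply: (@leq_trans (\sum_(v : G) #|U :\: closed_nbhd v|)).
    by rewrite mulnC -sum_nat_const; apply: leq_sum => v _; apply: minw.
  under eq_bigr => v _ do rewrite -sum1_card big_mkcond.
  rewrite exchange_big -sum_nat_const [leqRHS]big_mkcond /=.
  apply: leq_sum => u _; rewrite -big_mkcond sum1dep_card /=.
  case: (boolP (u \in U)) => uU; last first.
    rewrite (_ : finset _ = set0) ?cards0 //; apply/setP=> v; rewrite !inE in uU *.
    by rewrite (negPf uU) andbF.
  apply: leq_trans (degG u); apply/subset_leq_card/subsetP=> v.
  by rewrite !inE eq_sym edge_sym => /andP[].
exists (w |: S).
  by rewrite cardsU1; case: (w \in S) => //=; rewrite ?add1n ?ltnS ?(leqW cS).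
have -> : ~: closed_nbhds (w |: S) = U :\: closed_nbhd w.
  by rewrite /closed_nbhds bigcup_setU big_set1 setCU setDE setIC.
move: avg US; rewrite !expnS -/U; move: #|U| #|U :\: _| => a b.
by move: (#|G| ^ k) (d ^ k) #|G| => c e n *; nia.
Qed.

(** Any vertex shares two neighbours with [v], so $N(v)$ with one vertex [w] deleted is still a
    dominating set. *)
Lemma degree_ge :
  (forall u v : G, 2 <= #|nbhd u :&: nbhd v|) ->
  forall v : G, power_domination_number G < #|nbhd v|.
Proof.
move=> common v; have /card_gt0P[w] : 0 < #|nbhd v :&: nbhd v|.
  exact: ltnW (common v v).
rewrite setIid => vw; rewrite [X in _ < X](cardsD1 w) vw ltnS.
apply/power_domination_number_min/dominating_power/setP=> x; rewrite inE.
have : 0 < #|(nbhd v :&: nbhd x) :\ w|.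
  by have := common v x; rewrite (cardsD1 w); case: (w \in _); lia.
case/card_gt0P=> u; rewrite !inE => /and3P[uw vu xu].
by apply: (@mem_closed_nbhdsI _ _ u); rewrite ?inE ?uw // edge_sym xu orbT.
Qed.

(** By [degree_ge] a closed neighbourhood misses at most $n - 2 - q$ vertices. The greedy choice of
    $q - 1$ vertices must leave at least two undominated, as a defect of one would make it power
    dominating. *)
Lemma power_domination_greedy :
  0 < #|G| -> (forall u v : G, 2 <= #|nbhd u :&: nbhd v|) ->
  let n := #|G| in let q := power_domination_number G in
  0 < q -> 2 * n ^ q.-1 <= n * (n - 2 - q) ^ q.-1.
Proof.
move=> n0 common n q q0.
have deg (v : G) : #|~: closed_nbhd v| <= n - 2 - q.
  have := cardsC (closed_nbhd v); have := degree_ge common v.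
  by rewrite cardsU1 inE edge_irr /n /q; lia.
have [S cS US] := greedy_dominating n0 deg q.-1.
apply: leq_trans US; rewrite leq_mul2r; apply/orP; right.
rewrite leqNgt ltnS; apply/negP=> U1; have := @power_domination_number_min _ S.
rewrite power_dominating_defect //; last first.
  move=> v; have /card_gt0P[w] := ltnW (common v v).
  by rewrite !inE => /andP[vw _]; exists w.
by move/(_ isT); rewrite -/q; lia.
Qed.
End Greedy.

(** * A graph and its complement as two colours *)

Section TwoColours.
Variable G : sgraph.
Implicit Types (u v w x y : G).

Local Notation co_nbhd v := (@nbhd (complement G) v : {set G}).

Lemma edge_complement x y :
  @edge (complement G) x y = (x != y) && ~~ edge x y.
Proof. by []. Qed.

Lemma mem_co_nbhd v w : (w \in co_nbhd v) = (v != w) && ~~ edge v w.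
Proof. by rewrite inE. Qed.

Lemma card_co_nbhd v : #|nbhd v| + #|co_nbhd v| = #|G| - 1.
Proof.
have := cardsC (closed_nbhd v); rewrite cardsU1 inE edge_irr /=.
rewrite (_ : ~: closed_nbhd v = co_nbhd v); first lia.
by apply/setP=> w; rewrite mem_co_nbhd !inE negb_or eq_sym.
Qed.

Lemma undominated_pair u v :
  ~: closed_nbhds [set u; v] = co_nbhd u :&: co_nbhd v.
Proof.
apply/setP=> w; rewrite in_setC in_setI !mem_co_nbhd -!negb_or ![_ == w]eq_sym.
congr (~~ _); apply/mem_closed_nbhds/orP.
  by case=> x; rewrite !inE => /orP[]/eqP-> ->; [left | right].
by case=> h; [exists u | exists v]; rewrite ?inE ?eqxx ?orbT.
Qed.

Lemma undominated_pair_co u v :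
  ~: @closed_nbhds (complement G) [set u; v] = nbhd u :&: nbhd v.
Proof.
apply/setP=> w; rewrite !inE; apply/idP/idP.
  move=> h; suff aux x : x \in [set u; v] -> edge x w.
    by rewrite !aux ?inE ?eqxx ?orbT.
  move=> xuv; apply: contraR h => xw.
  apply: (@mem_closed_nbhdsI (complement G) _ x) => //=.
  by rewrite /co_edge /= eq_sym xw andbT orbN.
move=> /andP[uw vw]; apply/negP=> /mem_closed_nbhds[x].
rewrite !inE /= /co_edge /= => /orP[]/eqP->; rewrite ?uw ?vw andbF orbF => /eqP wE.
  by rewrite wE edge_irr in uw.
by rewrite wE edge_irr in vw.
Qed.

Lemma twins_co x y : @twins (complement G) x y = twins x y.
Proof.
rewrite /twins; congr (_ && _); apply: eq_forallb => w.
rewrite /= /co_edge /=; case: eqP => //= _; case: eqP => //= _.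
by rewrite (inj_eq negb_inj).
Qed.

(** Double counting of the walks $u, x, v$ (with $u = v$ allowed), weighted by their midpoint: each
    [x] is the midpoint of $\deg(x)^2$ of them. *)
Lemma sum_common_nbrs (F : G -> nat) :
  \sum_u \sum_v \sum_(x in nbhd u :&: nbhd v) F x
    = \sum_(x : G) F x * #|nbhd x| ^ 2.
Proof.
have degE x : #|nbhd x| = \sum_(u : G) edge u x.
  by rewrite -sum1_card big_mkcond; apply: eq_bigr => u _; rewrite inE edge_sym; case: edge.
transitivity (\sum_(u : G) \sum_(v : G) \sum_(x : G) F x * (edge u x * edge v x)).
  apply: eq_bigr => u _; apply: eq_bigr => v _; rewrite big_mkcond.
  apply: eq_bigr => x _; rewrite !inE.
  by case: edge; case: edge; rewrite ?muln0 ?muln1.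
under eq_bigr => u _ do rewrite exchange_big.
rewrite exchange_big; apply: eq_bigr => x _ /=.
under eq_bigr => u _ do rewrite -big_distrr -big_distrr /= -degE.
by rewrite -big_distrr -big_distrl /= -degE -mulnn.
Qed.

End TwoColours.

(** * Counting common neighbours and twins *)

Section Counting.
Variables (G : sgraph) (n M : nat).
Local Notation co_nbhd v := (@nbhd (complement G) v : {set G}).
Local Notation tau := (\sum_(x : G) \sum_(y : G) (twins x y : nat)).
Hypotheses (cardG : #|G| = n) (n7 : 7 <= n).
Hypothesis common : forall u v : G, 2 <= #|nbhd u :&: nbhd v|.
Hypothesis co_common : forall u v : G, 2 <= #|co_nbhd u :&: co_nbhd v|.
Hypothesis squares : forall v : G, #|nbhd v| ^ 2 + #|co_nbhd v| ^ 2 <= M.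

Lemma sum_common_le (F : G -> nat) :
  \sum_u \sum_v (\sum_(x in nbhd u :&: nbhd v) F x
                 + \sum_(x in co_nbhd u :&: co_nbhd v) F x)
    <= (\sum_x F x) * M.
Proof.
under eq_bigr => u _ do rewrite big_split.
rewrite big_split /= sum_common_nbrs (@sum_common_nbrs (complement G)).
rewrite -big_split big_distrl /=; apply: leq_sum => x _.
by rewrite -mulnDr leq_mul2l squares orbT.
Qed.

Lemma sum_diagonal a b :
  \sum_(u : G) \sum_(v : G) (a * (u == v) + b) = n * a + n * (n * b).
Proof.
under eq_bigr => u _ do rewrite big_split sum_nat_const cardG -big_distrr /=.
rewrite big_split sum_nat_const cardG /=; congr (_ + _).
rewrite -cardG -sum_nat_const; apply: eq_bigr => u _.
rewrite (bigD1 u) //= eqxx big1 ?muln1 ?addn0 // => v.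
by rewrite eq_sym => /negPf->.
Qed.

(** An ordered pair of distinct vertices has at least 4 common neighbours over the two colours.
    Twins have $n - 2$, since every other vertex sees both in the same colour. The diagonal
    contributes $n - 1 = (n - 5) + 4$. This bounds the number [tau] of ordered twin pairs from
    above. *)
Lemma twins_count : n * (n - 5) + n * (n * 4) + (n - 6) * tau <= n * M.
Proof.
have := sum_common_le (fun=> 1); rewrite sum_nat_const cardG muln1.
apply: leq_trans; rewrite -sum_diagonal big_distrr -big_split /=.
apply: leq_sum => u _; rewrite big_distrr -big_split /=.
apply: leq_sum => v _; rewrite !sum1_card.
have [<-|uv] := eqVneq u v.
  rewrite !setIid card_co_nbhd cardG /twins eqxx /=; lia.
have := common u v; have := co_common u v.
case tw: (twins u v); last by lia.
suff : n - 2 <= #|nbhd u :&: nbhd v| + #|co_nbhd u :&: co_nbhd v| by lia.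
apply: leq_trans (leq_card_setU _ _).
have <- : #|[set~ u] :\ v| = n - 2.
  have := cardsC1 u; rewrite cardG (cardsD1 v) !inE eq_sym uv /=; lia.
apply/subset_leq_card/subsetP=> w; rewrite in_setU !in_setI !mem_co_nbhd !inE.
case/andP=> wv wu; rewrite ![_ == w]eq_sym wv wu /=.
case/andP: tw => _ /forallP/(_ w); rewrite wv wu /= ![edge w _]edge_sym => /eqP->.
by case: edge.
Qed.

Hypothesis twin_pair : forall u v x y : G, x != y ->
  nbhd u :&: nbhd v = [set x; y] -> twins x y.
Hypothesis twin_co_pair : forall u v x y : G, x != y ->
  co_nbhd u :&: co_nbhd v = [set x; y] -> twins x y.

Lemma twins_sym (x y : G) : twins x y = twins y x.
Proof.
rewrite /twins eq_sym; congr (_ && _); apply: eq_forallb => w.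
by case: eqP; case: eqP; rewrite //= eq_sym.
Qed.

(** Three vertices weigh at least 2 each; if there are only two, they are twins and weigh at least 3
    each. *)
Lemma weighted_common_ge (C : {set G}) :
  2 <= #|C| -> (forall x y, x != y -> C = [set x; y] -> twins x y) ->
  6 <= \sum_(x in C) (2 + \sum_y twins x y).
Proof.
move=> C2 twC; rewrite big_split /= sum_nat_const.
have [C3|C3] := leqP 3 #|C|; first by lia.
have /cards2P[x [y [xy CE]]] : #|C| == 2 by lia.
have txy := twC x y xy CE.
rewrite CE cards2 xy big_setU1 ?inE //= big_set1.
have tw_pos (a b : G) : twins a b -> 1 <= \sum_c twins a c.
  by move=> ab; rewrite (bigD1 b) //= ab.
have := tw_pos x y txy; have := tw_pos y x; rewrite twins_sym txy => /(_ isT).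
lia.
Qed.

(** The weight 2 plus the number of twins gives every pair at least 6 in each colour. The diagonal
    has at least $2(n - 1) = (2n - 14) + 12$. As the total weight is $2n + \tau$, this bounds [tau]
    from below. *)
Lemma twins_weighted_count :
  n * (2 * n - 14) + n * (n * 12) <= (2 * n + tau) * M.
Proof.
have := sum_common_le (fun x => 2 + \sum_(y : G) twins x y).
rewrite big_split sum_nat_const cardG /= [n * 2]mulnC; apply: leq_trans.
rewrite -sum_diagonal; apply: leq_sum => u _; apply: leq_sum => v _.
have [<-|uv] := eqVneq u v.
  rewrite !setIid !big_split /= !sum_nat_const; have := card_co_nbhd u; rewrite cardG; lia.
have := weighted_common_ge (common u v) (@twin_pair u v).
have := weighted_common_ge (co_common u v) (@twin_co_pair u v).
lia.
Qed.
End Counting.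

(** * What the order of components says about small neighbourhoods *)

Section Connectivity.
Variable G : sgraph.
Implicit Types (C A : {set G}) (v w x y z : G).

Lemma connected_exit C A x :
  connected_set C -> x \in C -> x \in A -> ~~ (C \subset A) ->
  exists2 a, a \in A & exists2 b, b \in C :\: A & edge a b.
Proof.
case/andP=> _ /forall_inP conC xC xA /subsetPn[y yC yA].
have /forall_inP/(_ y yC)/connectP[p pth yE] := conC x xC.
elim: p x xA pth yE {xC} => [|z p IH] x xA /= => [_ yx|/andP[/and3P[_ zC xz] pth] yE].
  by rewrite yx xA in yA.
by case: (boolP (z \in A)) => zA; [exact: (IH z) | exists x => //; exists z; rewrite // inE zA].
Qed.

Lemma connected_star v : connected_set (closed_nbhd v).
Proof.
apply/andP; split; first by apply/set0Pn; exists v; rewrite setU11.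
set r := [rel _ _ | _]; have rsym : connect_sym r.
  by apply: sym_connect_sym => a b; rewrite /= edge_sym andbCA.
have conv x : x \in closed_nbhd v -> connect r v x.
  move=> xv; case/setU1P: (xv) => [->|vx]; first exact: connect0.
  by apply: connect1; rewrite /= setU11 xv; rewrite inE in vx.
apply/forall_inP=> x xv; apply/forall_inP=> y yv.
by apply: connect_trans (conv y yv); rewrite rsym conv.
Qed.

Lemma component_exists C :
  connected_set C -> exists2 D, component D & C \subset D.
Proof. by case/maxset_exists=> D; exists D. Qed.

Lemma connectedU C D x :
  connected_set C -> connected_set D -> x \in C -> x \in D ->
  connected_set (C :|: D).
Proof.
move=> /andP[_ /forall_inP conC] /andP[_ /forall_inP conD] xC xD.
apply/andP; split; first by apply/set0Pn; exists x; rewrite inE xC.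
set r := [rel _ _ | _]; have rsym : connect_sym r.
  by apply: sym_connect_sym => a b; rewrite /= edge_sym andbCA.
have conx y : y \in C :|: D -> connect r x y.
  case/setUP=> [yC|yD].
    have /forall_inP/(_ y yC) := conC x xC; apply: connect_sub => a b /= /and3P[aC bC ab].
    by apply: connect1; rewrite /= !inE aC bC ab.
  have /forall_inP/(_ y yD) := conD x xD; apply: connect_sub => a b /= /and3P[aC bC ab].
  by apply: connect1; rewrite /= !inE aC bC ab !orbT.
apply/forall_inP=> y yv; apply/forall_inP=> z zv.
by apply: connect_trans (conx z zv); rewrite rsym conx.
Qed.

Lemma components_ge_closed_nbhd k :
  (forall v : G, k <= #|closed_nbhd v|) -> components_ge G k.
Proof.
move=> degG C /maxsetP[conC maxC]; have /andP[/set0Pn[v vC] _] := conC.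
have vv : v \in closed_nbhd v by rewrite setU11.
have <- := maxC _ (connectedU conC (connected_star v) vC vv) (subsetUl _ _).
by apply: leq_trans (degG v) _; apply/subset_leq_card/subsetUr.
Qed.

(** At most two vertices cannot fill a component, so some edge leaves [A]. A single vertex as [A]
    excludes isolated vertices, an edge as [A] excludes components $K_2$. *)
Lemma components_ge3_exit A x :
  components_ge G 3 -> connected_set A -> x \in A -> #|A| <= 2 ->
  exists2 a, a \in A & exists2 b, b \notin A & edge a b.
Proof.
move=> comp3 conA xA A2; have [D compD sAD] := component_exists conA.
have /maxsetP[conD _] := compD.
have [a aA [b bDA ab]] : exists2 a, a \in A & exists2 b, b \in D :\: A & edge a b.
  apply: (connected_exit conD (subsetP sAD x xA) xA); apply/negP=> /subset_leq_card.
  by have := comp3 D compD; lia.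
by exists a => //; exists b; last exact: ab; case/setDP: bDA.
Qed.

Lemma components_ge3_noiso :
  components_ge G 3 -> forall v, exists w, edge v w.
Proof.
move=> comp3 v; apply/existsP; apply: contraT => /existsPn iso.
have vE : closed_nbhd v = [set v].
  by apply/setP=> w; rewrite !inE (negPf (iso w)) orbF.
have con := connected_star v; rewrite vE in con.
have := components_ge3_exit comp3 con (set11 v); rewrite cards1.
by case=> // a /set1P-> [b _]; rewrite (negPf (iso b)).
Qed.

Lemma components_ge3_noK2 :
  components_ge G 3 -> forall v w, edge v w ->
  exists z, [&& z != v, z != w & edge v z || edge w z].
Proof.
move=> comp3 v w vw; apply/existsP; apply: contraT => /existsPn noz.
have vE : closed_nbhd v = [set v; w].
  apply/setP=> z; rewrite !inE; case: eqVneq => //= zv; case: eqVneq => [->|zw] //=.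
  by have := noz z; rewrite zv zw /=; case: (edge v z).
have con := connected_star v; rewrite vE in con.
have := components_ge3_exit comp3 con (set21 v w).
have -> : #|[set v; w]| <= 2 by rewrite cards2; case: eqP.
case=> // a aA [b]; rewrite !inE negb_or => /andP[bv bw] ab.
have := noz b; rewrite bv bw /= negb_or; case/set2P: aA ab => -> ->; rewrite ?andbF //.
Qed.

End Connectivity.

(** * Structure when both numbers are at least 3 *)

Section NordhausGaddum.
Variable G : sgraph.
Hypothesis comp : components_ge G 3.
Hypothesis co_comp : components_ge (complement G) 3.
Local Notation co_nbhd v := (@nbhd (complement G) v : {set G}).

Lemma undominated_pair_ge (H : sgraph) (u v : H) :
  (forall v : H, exists w, edge v w) -> 3 <= power_domination_number H ->
  2 <= #|~: closed_nbhds [set u; v]|.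
Proof.
move=> noiso p3; rewrite leqNgt ltnS; apply/negP=> /(power_dominating_defect noiso).
move/power_domination_number_min; rewrite cards2; case: eqP => _; lia.
Qed.

Lemma undominated_pair_twins (H : sgraph) (u v x y : H) :
  (forall v : H, exists w, edge v w) -> 3 <= power_domination_number H ->
  x != y -> ~: closed_nbhds [set u; v] = [set x; y] -> twins x y.
Proof.
move=> noiso p3 xy UE; apply: (defect2_twins noiso xy UE); apply/negP.
move/power_domination_number_min; rewrite cards2; case: eqP => _; lia.
Qed.

Let noiso := components_ge3_noiso comp.
Let co_noiso := components_ge3_noiso co_comp.
Local Notation p := (power_domination_number G).
Local Notation q := (power_domination_number (complement G)).

Hypotheses (p3 : 3 <= p) (q3 : 3 <= q).

(** The colours cross over: a pair with fewer than two common neighbours in [G] would power dominate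
    the complement, against $q \ge 3$. *)
Lemma common_ge2 (u v : G) : 2 <= #|nbhd u :&: nbhd v|.
Proof. by rewrite -undominated_pair_co; apply: (@undominated_pair_ge (complement G)). Qed.

Lemma co_common_ge2 (u v : G) : 2 <= #|co_nbhd u :&: co_nbhd v|.
Proof. by rewrite -undominated_pair; apply: undominated_pair_ge. Qed.

Lemma order_neq_10_11 : (#|G| != 10) && (#|G| != 11).
Proof.
have d4 (v : G) : 4 <= #|nbhd v|.
  exact: leq_ltn_trans p3 (degree_ge common_ge2 v).
have co_d4 (v : G) : 4 <= #|co_nbhd v|.
  exact: leq_ltn_trans q3 (@degree_ge (complement G) co_common_ge2 v).
have twp (u v x y : G) : x != y -> nbhd u :&: nbhd v = [set x; y] -> twins x y.
  rewrite -undominated_pair_co -twins_co.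
  exact: (@undominated_pair_twins (complement G)).
have co_twp (u v x y : G) : x != y -> co_nbhd u :&: co_nbhd v = [set x; y] -> twins x y.
  by rewrite -undominated_pair; apply: undominated_pair_twins.
apply/andP; split; apply/eqP=> cardG.
  (* Degrees 4 and 5 are the only possibility, and $41 = 4^2 + 5^2$; the count then demands $450 \le
     410$. *)
  have sq (v : G) : #|nbhd v| ^ 2 + #|co_nbhd v| ^ 2 <= 41.
    have := card_co_nbhd v; have := d4 v; have := co_d4 v; rewrite cardG.
    by move: #|_| #|_| => a b *; rewrite -!mulnn; nia.
  have := twins_count cardG isT common_ge2 co_common_ge2 sq; lia.
(* The extreme degrees are 4 and 6, and $52 = 4^2 + 6^2$. The two counts then give $\tau \le 4$ and
   $\tau \ge 8$. *)
have sq (v : G) : #|nbhd v| ^ 2 + #|co_nbhd v| ^ 2 <= 52.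
  have := card_co_nbhd v; have := d4 v; have := co_d4 v; rewrite cardG.
  by move: #|_| #|_| => a b *; rewrite -!mulnn; nia.
have := twins_count cardG isT common_ge2 co_common_ge2 sq.
have := twins_weighted_count cardG isT common_ge2 co_common_ge2 sq twp co_twp.
lia.
Qed.

Lemma product_le : p * q <= #|G|.
Proof.
apply: jaeger_payan => S domS;
  exact: power_domination_number_min (dominating_power domS).
Qed.

End NordhausGaddum.

(** * Arithmetic of the constraints, and the upper bound *)

Lemma mul_exp2_lt_exp3 k : 7 <= k -> (3 * k + 5) * 2 ^ k < 2 * 3 ^ k.
Proof.
move=> k7; have [j ->] : exists j, k = j + 7 by exists (k - 7); lia.
elim: j => [|j IH]; first by rewrite /= add0n; lia.
rewrite addSn !expnS; move: IH; move: (2 ^ _) (3 ^ _) => a b; nia.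
Qed.

(** Since $3(n - 2 - k) \le 2n$ and $n \le 3(k - 1) + 5$, [mul_exp2_lt_exp3] settles $k \ge 8$.
    Smaller [k] means $n \le 23$, and the eight remaining orders are evaluated. *)
Lemma greedy_third_lt n k :
  9 <= n -> n \notin [:: 10; 11; 13; 14; 16; 17; 20] ->
  k = n %/ 3 -> n * (n - 2 - k) ^ k.-1 < 2 * n ^ k.-1.
Proof.
move=> n9 nexc kE; have [k8|k7] := leqP 8 k.
  have h1 := @mul_exp2_lt_exp3 k.-1 ltac:(lia).
  have h2 : (3 * (n - 2 - k)) ^ k.-1 <= (2 * n) ^ k.-1.
    by rewrite leq_exp2r; lia.
  move: h2; rewrite !expnMn => h2.
  have h3 : n <= 3 * k.-1 + 5 by lia.
  have h4 : 0 < 3 ^ k.-1 by rewrite expn_gt0.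
  have h5 : 0 < n ^ k.-1 by rewrite expn_gt0; lia.
  rewrite -(ltn_pmul2l h4).
  apply: (@leq_ltn_trans (n * (2 ^ k.-1 * n ^ k.-1))).
    by rewrite mulnCA leq_mul2l h2 orbT.
  rewrite !mulnA ltn_pmul2r // [_ * 2]mulnC; apply: leq_ltn_trans h1.
  by rewrite leq_mul2r h3 orbT.
have : (n, k) \in [:: (9, 3); (12, 4); (15, 5); (18, 6); (19, 6); (21, 7);
                      (22, 7); (23, 7)].
  by move: nexc; rewrite !inE !xpair_eqE; lia.
rewrite !inE; do ![case/predU1P=> [[-> ->]|]]; last case/eqP=> -> ->;
  by rewrite !subSS !subn0 /= !expnS expn0; lia.
Qed.

(** Outside the list the greedy inequality rules out that [p] or [q] equals $\lfloor n/3 \rfloor$,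
    which settles the case where one of them is 3. *)
Lemma sum_le_third n p q :
  3 <= p -> 3 <= q -> 3 * p <= n -> 3 * q <= n -> p * q <= n ->
  n \notin [:: 10; 11] ->
  2 * n ^ p.-1 <= n * (n - 2 - p) ^ p.-1 ->
  2 * n ^ q.-1 <= n * (n - 2 - q) ^ q.-1 ->
  p + q <= n %/ 3 + 2 + (n \in [:: 13; 14; 16; 17; 20]).
Proof.
move=> p3 q3 third co_third pq n1011 greedy co_greedy.
have n9 : 9 <= n by nia.
have [exc|nexc] := boolP (n \in _); first by rewrite /=; nia.
have le_third k : 2 * n ^ k.-1 <= n * (n - 2 - k) ^ k.-1 -> k != n %/ 3.
  move=> le_k; apply/eqP=> kE; move: le_k; apply/negP; rewrite -ltnNge.
  apply: greedy_third_lt => //.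
  by clear -n1011 nexc; move: n1011 nexc; rewrite !inE; lia.
have := le_third p greedy; have := le_third q co_greedy.
clear -third co_third p3 q3 pq n9 nexc; move: nexc; rewrite !inE => nexc h1 h2.
have [p4|p4] := leqP 4 p; last by lia.
have [q4|q4] := leqP 4 q; last by lia.
(* From $(p - 4)(q - 4) \ge 0$ and $pq \le n$. *)
have : 4 * (p + q) <= n + 16 by nia.
lia.
Qed.

Lemma nordhaus_gaddum (G : sgraph) :
  0 < #|G| -> components_ge G 3 -> components_ge (complement G) 3 ->
  power_domination_number G + power_domination_number (complement G)
    <= #|G| %/ 3 + 2 + (#|G| \in [:: 13; 14; 16; 17; 20]).
Proof.
move=> n0 comp co_comp.
have := power_domination_third (components_ge3_noiso comp) (components_ge3_noK2 comp).
have := @power_domination_third (complement G)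
  (components_ge3_noiso co_comp) (components_ge3_noK2 co_comp).
have := product_le G; have := order_neq_10_11 comp co_comp.
have := fun p3 q3 => power_domination_greedy n0 (common_ge2 (G := G) co_comp q3) p3.
have := fun p3 q3 => @power_domination_greedy (complement G) n0 (co_common_ge2 comp p3) q3.
change #|complement G| with #|G|; rewrite /=.
move: (power_domination_number G) (power_domination_number (complement G)) #|G| => p q n.
move=> co_greedy greedy n1011 pq co_third third.
have [p3|p3] := leqP 3 p; last by clear -p3 co_third; lia.
have [q3|q3] := leqP 3 q; last by clear -q3 third; lia.
apply: sum_le_third => //; last 2 first.
- exact: greedy (ltnW (ltnW p3)) q3.
- exact: co_greedy p3 (ltnW (ltnW q3)).
by rewrite !inE negb_or; apply: n1011.
Qed.

(** * Sharpness: disjoint triangles *)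

Section CopiesK3.
Variable r : nat.
Hypothesis r2 : 2 <= r.
Local Notation G := (copies r (complete_graph 3)).

Lemma card_copies : #|G| = 3 * r.
Proof. by rewrite card_prod !card_ord mulnC. Qed.

Lemma copies_closed_nbhd (v : G) : closed_nbhd v = [set u : G | u.1 == v.1].
Proof.
apply/setP=> -[i x]; case: v => j y; rewrite !inE /= /copies_edge /= xpair_eqE.
by rewrite eq_sym /complete_edge /= [x == y]eq_sym; case: eqP; case: eqP.
Qed.

Lemma card_copy (i : 'I_r) : #|[set u : G | u.1 == i]| = 3.
Proof.
have -> : [set u : G | u.1 == i] = setX [set i] [set: 'I_3].
  by apply/setP=> u; rewrite !inE andbT.
by rewrite cardsX cards1 cardsT card_ord.
Qed.

Lemma copies_components : components_ge G 3.
Proof.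
apply: components_ge_closed_nbhd => v.
by rewrite copies_closed_nbhd card_copy.
Qed.

Lemma copies_degree (v : G) : #|nbhd v| = 2.
Proof.
have := card_copy v.1; rewrite -copies_closed_nbhd cardsU1 inE edge_irr /=.
by rewrite add1n => -[].
Qed.

Lemma co_copies_components : components_ge (complement G) 3.
Proof.
apply: components_ge_closed_nbhd => v; rewrite cardsU1 inE edge_irr /=.
have := @card_co_nbhd G v; rewrite card_copies copies_degree.
by move: #|_| => d; lia.
Qed.

(** No edge joins two copies, so the complement of a copy missed by [S] is stalled and contains
    $N[S]$. *)
Lemma copies_number_ge : r <= power_domination_number G.
Proof.
have [S /power_dominatingP pdS <-] := power_domination_number_attained G.
suff full : [set: 'I_r] \subset [set u.1 | u in S].
  rewrite -{1}[r]card_ord -cardsT.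
  exact: leq_trans (subset_leq_card full) (leq_imset_card _ _).
apply/subsetP=> i _; apply: contraT => iS.
have : ~: [set u : G | u.1 == i] = setT.
  apply: pdS.
    apply/subsetP=> w /mem_closed_nbhds[v vS vw]; rewrite !inE.
    have /eqP -> : w.1 == v.1.
      by case/orP: vw => [/eqP->|/andP[/eqP->]].
    by apply: contraNneq iS => <-; apply/imsetP; exists v.
  apply/forall_inP=> v; rewrite !inE => vi.
  rewrite (_ : _ :\: _ = set0) ?cards0 //; apply/setP=> w; rewrite !inE negbK.
  by apply/andP=> -[/eqP wi /andP[/eqP vw _]]; rewrite vw wi eqxx in vi.
move/setP/(_ (i, ord0)); by rewrite !inE eqxx.
Qed.

(** In the complement, a single [v] leaves the two other vertices of its triangle undominated. This
    is stalled: [v] sees neither of them, and every vertex of another copy sees both. *)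
Lemma co_copies_number_ge : 2 <= power_domination_number (complement G).
Proof.
have [S /power_dominatingP pdS <-] := power_domination_number_attained (complement G).
rewrite ltnNge; apply/negP=> S1.
have r0 : 0 < r by apply: leq_trans r2.
have [v Sv] : exists v : G, S \subset [set v].
  have [->|[v vS]] := set_0Vmem S; first by exists (Ordinal r0, ord0); rewrite sub0set.
  by exists v; move: S1; rewrite (cardsD1 v) vS ltnS leqn0 cards_eq0 setD_eq0.
have copyE (u w : G) : u.1 = w.1 -> w \in closed_nbhd u.
  by move=> uw; rewrite copies_closed_nbhd inE uw.
have Nv2 := copies_degree v.
have : ~: nbhd v = setT.
  apply: pdS.
    apply/subsetP=> w /mem_closed_nbhds[u uS uw]; rewrite !inE.
    have uv : u = v by apply/set1P/(subsetP Sv).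
    rewrite uv in uw; apply: contraL uw => vw.
    rewrite (edge_complement (v : G)) vw andbF orbF.
    by apply: contraTneq vw => ->; rewrite edge_irr.
  apply/forall_inP=> u uP; have [uv|uv] := eqVneq u.1 v.1.
    have {uv} -> : u = v.
      have := copyE v u (esym uv); rewrite !inE in uP *.
      by rewrite (negPf uP) orbF => /eqP.
    rewrite (_ : _ :\: _ = set0) ?cards0 //; apply/setP=> w.
    by rewrite !inE negbK (edge_complement (v : G)); case: (edge v w); rewrite ?andbF.
  rewrite (_ : _ :\: _ = nbhd v) ?Nv2 //; apply/setP=> w.
  rewrite in_setD !inE negbK (edge_complement (u : G)); case vw: (edge v w) => //=.
  have wv : w.1 = v.1 by case/andP: vw => /eqP.
  apply/andP; split; first by apply: contraNneq uv => ->; rewrite wv.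
  by apply: contraNN uv => /andP[/eqP uw _]; rewrite uw wv.
move=> /(congr1 (fun A : {set G} => #|~: A|)).
by rewrite setCK Nv2 setCT cards0.
Qed.
End CopiesK3.

Theorem theorem3p2 :
  [/\ forall G : sgraph,
        0 < #|G| ->
        components_ge G 3 ->
        components_ge (complement G) 3 ->
        #|G| \notin [:: 13; 14; 16; 17; 20] ->
        power_domination_number G + power_domination_number (complement G)
          <= #|G| %/ 3 + 2,
      forall r : nat, 2 <= r ->
        let G := copies r (complete_graph 3) in
        [/\ #|G| = 3 * r,
            #|G| \notin [:: 13; 14; 16; 17; 20],
            components_ge G 3,
            components_ge (complement G) 3
          & power_domination_number G + power_domination_number (complement G)
              = #|G| %/ 3 + 2]
    & forall G : sgraph,
        0 < #|G| ->
        components_ge G 3 ->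
        components_ge (complement G) 3 ->
        #|G| \in [:: 13; 14; 16; 17; 20] ->
        power_domination_number G + power_domination_number (complement G)
          <= #|G| %/ 3 + 3].
Proof.
split.
- move=> G n0 comp co_comp nexc; have := nordhaus_gaddum n0 comp co_comp.
  by rewrite (negPf nexc) addn0.
- move=> r r2 G; have cardG : #|G| = 3 * r := card_copies r.
  have nexc : #|G| \notin [:: 13; 14; 16; 17; 20] by rewrite cardG !inE; lia.
  have comp : components_ge G 3 := @copies_components r.
  have co_comp : components_ge (complement G) 3 := co_copies_components r2.
  split=> //; apply/eqP; rewrite eqn_leq; apply/andP; split.
    have n0 : 0 < #|G| by rewrite cardG; lia.
    by have := nordhaus_gaddum n0 comp co_comp; rewrite (negPf nexc) addn0.
  rewrite cardG mulKn //; apply: leq_add; first exact: copies_number_ge.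
  exact: co_copies_number_ge.
- move=> G n0 comp co_comp exc; have := nordhaus_gaddum n0 comp co_comp.
  by rewrite exc addn1 -addnS.
Qed.
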